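(* Let $M\in\mathbb{R}^{d\times d}$ be symmetric positive definite, let $S\in\mathbb{R}^{d\times d}$ be constant with $S^\top=-S$ or $S\preceq0$, and let $V:\mathbb{R}^d\to\mathbb{R}$ be differentiable. Let $D(t)\in\mathbb{R}^{d\times d}$ be continuous in $t$ with $\operatorname{sym}(MD(t))\succeq0$ for all $t$. Let $h>0$, $t_{n+1}=t_n+h$, $A=hSM$, and let $z^n,z^-,z^+,z^{n+1}\in\mathbb{R}^d$ and $V^-,V^+,\eta^{n+\frac12}\in\mathbb{R}$ satisfy one step of the SEILM scheme, with precomputed predictor $\hat z^{\,n+\frac12}\in\mathbb{R}^d$ and $\tilde g=\nabla V(\hat z^{\,n+\frac12})$: $$(z^-,V^-)=\big(\Psi^{(t_n,\,t_n+\frac h2)}z^n,\;V(z^n)\big),$$ $$z^+=e^Az^-+h\,\varphi_1(A)\,S\,\tilde g\,\eta^{n+\frac12},\qquad V^+-V^-=\eta^{n+\frac12}\,\tilde g^\top(z^+-z^-),$$ $$(z^{n+1},V(z^{n+1}))=\big(\Psi^{(t_n+\frac h2,\,t_{n+1})}z^+,\;V^+\big).$$ Then the original energy $H(z)=\tfrac12z^\top Mz+V(z)$ is dissipated: $$H(z^{n+1})-H(z^n)\le0 .$$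
   Context: $\operatorname{sym}(B)=\tfrac12(B+B^\top)$. $B\succeq0$ means symmetric positive semidefinite. $S\preceq0$ means that $\operatorname{sym}(S)$ is negative semidefinite ($S$ need not be symmetric). $\Psi^{(a,b)}=\exp\big(-\int_a^bD(\tau)\,d\tau\big)$ is the evolution operator of the linear damping subflow $\dot z=-D(t)z$. $\varphi_1(x)=\frac{e^x-1}{x}$ is the entire function $\sum_{k\ge0}x^k/(k+1)!$, applied to matrices through its power series. The numbers $V^\pm$ are values of a scalar potential variable that is kept unchanged during the damping substeps; the last line of the scheme imposes $V(z^{n+1})=V^+$, and $\eta^{n+\frac12}$ is a scalar multiplier. The vector $\hat z^{\,n+\frac12}$ is an input to the step, computed beforehand; in practice it is a locally second-order approximation of the solution at $t_n+h/2$. The scheme is a Strang splitting for $\dot z=S\nabla H(z)-D(t)z$. *)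

(* Defs.v *)
From HB Require Import structures.
From mathcomp Require Import all_boot all_order all_algebra.
From mathcomp Require Import all_classical all_reals all_analysis.

Set Implicit Arguments.
Unset Strict Implicit.
Unset Printing Implicit Defensive.

Import Order.TTheory GRing.Theory Num.Theory.
Import numFieldNormedType.Exports.

Local Open Scope classical_set_scope.
Local Open Scope ring_scope.

Section MatrixOrder.
Variables (R : realType) (d : nat).
Implicit Types (B : 'M[R]_d) (x y : 'cV[R]_d).

Definition dotv x y : R := (x^T *m y) 0 0.

Definition symm B : 'M[R]_d := 2^-1 *: (B + B^T).

Definition spd B : Prop := B^T = B /\ forall x, x != 0 -> 0 < dotv x (B *m x).

Definition psd B : Prop := B^T = B /\ forall x, 0 <= dotv x (B *m x).

Definition nsd B : Prop := B^T = B /\ forall x, dotv x (B *m x) <= 0.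

End MatrixOrder.

Section MatrixFunctions.
Variables (R : realType) (d : nat).
Implicit Types (A : 'M[R]_d) (D : R -> 'M[R]_d) (V : 'cV[R]_d -> R).

(* The limit is taken in the normed topology of 'M[R]_d. *)
Definition mx_pseries (c : nat -> R) A : 'M[R]_d :=
  lim (series (fun k : nat => c k *: A ^+ k) @ \oo).

Definition expmx A : 'M[R]_d := mx_pseries (fun k => (k`!)%:R^-1) A.

Definition phi1mx A : 'M[R]_d := mx_pseries (fun k => (k.+1`!)%:R^-1) A.

(* Entrywise integral over [a, b]; it is the oriented integral for a <= b
   only. *)
Definition integral_mx D (a b : R) : 'M[R]_d :=
  \matrix_(i, j) Rintegral lebesgue_measure `[a, b]%classic (fun t => D t i j).

(* Ordinary, not time-ordered, exponential: when the D t do not commute, it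
   need not be the propagator of z' = - D(t) z. *)
Definition damping_flow D (a b : R) : 'M[R]_d := expmx (- integral_mx D a b).

Definition gradient V (z : 'cV[R]_d) : 'cV[R]_d :=
  \col_i 'D_(delta_mx i 0) V z.

Definition energy (M : 'M[R]_d) V (z : 'cV[R]_d) : R :=
  2^-1 * dotv z (M *m z) + V z.

End MatrixFunctions.

(* Main.v *)
Require Import Defs.
From HB Require Import structures.
From mathcomp Require Import all_boot all_order all_algebra.
From mathcomp Require Import all_classical all_reals all_analysis.
From mathcomp Require Import ring lra.

(** Write Q(z) = z^T M z / 2. The proof rests on one fact: if the quadratic form
of M B is nonpositive, then exp B does not increase Q
(expmx_contraction). Indeed t |-> Q(exp(t B) x) has derivative
y^T M B y <= 0 at y = exp(t B) x, hence it is nonincreasing on [0, 1].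

For a damping substep, B is minus the integral of D, and the form of M B is
minus the integral of the forms of the matrices M D(t), each of which is
nonnegative (damping_flow_contraction). Only the integrated matrix matters, so
the D(t) need not commute. As V is unchanged in these substeps, they do not
increase the energy.

For the middle substep, A = h S M and the form of M A at z is h times that of
S at M z, so it is nonpositive. Put g = eta * gt and w = M^-1 g. Since
h S g = A w and phi1(A) A = exp A - 1, the substep reads
zp + w = exp A (zm + w): the exponential integrator is the exact flow of the
quadratic part recentred at - w. Contraction of Q along it, once the squares are
expanded, gives Q(zp) + g^T zp <= Q(zm) + g^T zm
(exp_integrator_dissipation), and g^T (zp - zm) is exactly the change Vp - Vm of
the potential variable. The three inequalities add up to the claim.

The analytic input is that the matrix power series converge entrywise, by
comparison with the scalar exponential series (cvg_mx_pseries), whence the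
identity for phi1 (mul_phi1mx) and the derivative A exp(t A) of exp(t A)
(is_derive_expmx). *)

Set Implicit Arguments.
Unset Strict Implicit.
Unset Printing Implicit Defensive.

Import Order.TTheory GRing.Theory Num.Theory.
Import numFieldNormedType.Exports.

Local Open Scope classical_set_scope.
Local Open Scope ring_scope.

(** * Power series of matrices *)

Section MatrixPowerSeries.
Variables (R : realType) (d : nat).
Implicit Types (A B : 'M[R]_d) (c : nat -> R).

Lemma exprmxS A k : A ^+ k.+1 = A *m A ^+ k.
Proof. exact: exprS. Qed.

Lemma exprmxSr A k : A ^+ k.+1 = A ^+ k *m A.
Proof. exact: exprSr. Qed.

Lemma exprZmx (t : R) A k : (t *: A) ^+ k = t ^+ k *: A ^+ k.
Proof.
elim: k => [|k IHk]; first by rewrite !expr0 scale1r.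
by rewrite !exprmxS IHk -scalemxAl -scalemxAr scalerA -exprS.
Qed.

(** The sum of the moduli of all entries is a submultiplicative norm; the power
    k = 0 needs no exception, since the entries of the identity are 0 or 1. *)
Lemma norm_exprmx_entry A k i j :
  `|(A ^+ k) i j| <= (\sum_i \sum_j `|A i j|) ^+ k.
Proof.
set r := \sum_i _.
have r_ge0 : 0 <= r by apply: sumr_ge0 => a _; apply: sumr_ge0.
elim: k i j => [|k IHk] i j.
  rewrite !expr0 (_ : 1 = 1%:M) // mxE.
  by case: eqP; rewrite /= ?normr1 // normr0.
rewrite exprmxS mxE (le_trans (ler_norm_sum _ _ _)) //.
rewrite (@le_trans _ _ (\sum_l `|A i l| * r ^+ k)) //.
  by apply: ler_sum => l _; rewrite normrM ler_wpM2l.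
rewrite -mulr_suml exprS ler_wpM2r ?exprn_ge0 //.
rewrite [leRHS](bigD1 i) //= lerDl.
by apply: sumr_ge0 => a _; apply: sumr_ge0.
Qed.

Lemma cvg_mx_entry T (F : set_system T) {FF : Filter F} m n
    (f : T -> 'M[R]_(m, n)) (L : 'M[R]_(m, n)) :
  (forall i j, f x i j @[x --> F] --> L i j) -> f x @[x --> F] --> L.
Proof.
move=> fL; apply/cvg_mx_entourageP => E entE; rewrite !near_simpl.
have cvE i j := (@cvg_app_entourageP _ _ _ _ FF _).1 (fL i j) E entE.
have := filter_forall FF (fun i => filter_forall FF (cvE i)).
by apply: filterS => x Ex i j; rewrite inE; exact: Ex.
Qed.

Lemma cvg_mulmxr T (F : set_system T) {FF : Filter F} m n p
    (f : T -> 'M[R]_(m, n)) (L : 'M[R]_(m, n)) (B : 'M[R]_(n, p)) :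
  f x @[x --> F] --> L -> f x *m B @[x --> F] --> L *m B.
Proof.
move=> fL; apply: cvg_mx_entry => i j; rewrite mxE.
under eq_fun do rewrite mxE.
apply: (cvg_big add_continuous) => l _; apply: cvgMr_tmp.
exact: cvg_comp fL (@coord_continuous _ _ _ i l L).
Qed.

(** The bound 1 / k! on the coefficients covers both the exponential and
    phi1. *)
Lemma is_cvg_mx_pseries_entry c A i j : (forall k, `|c k| <= k`!%:R^-1) ->
  cvgn (series (fun k => c k * (A ^+ k) i j)).
Proof.
move=> c_le; apply: normed_cvg.
set r := \sum_i \sum_j `|A i j|.
apply: (series_le_cvg _ _ _ (is_cvg_series_exp_coeff r)) => k //=.
  rewrite /exp_coeff /= mulr_ge0 ?exprn_ge0 // sumr_ge0 // => a _.
  exact: sumr_ge0.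
by rewrite /exp_coeff /= normrM mulrC ler_pM // norm_exprmx_entry.
Qed.

Lemma series_mx_entry (u : nat -> 'M[R]_d) n i j :
  series u n i j = series (fun k => u k i j) n.
Proof. by rewrite /series /= summxE. Qed.

Lemma cvg_mx_pseries c A : (forall k, `|c k| <= k`!%:R^-1) ->
  series (fun k => c k *: A ^+ k) @ \oo --> mx_pseries c A.
Proof.
move=> c_le.
set L := \matrix_(i, j) limn (series (fun k => c k * (A ^+ k) i j)).
suff cvL : series (fun k => c k *: A ^+ k) @ \oo --> L.
  by rewrite /mx_pseries (cvg_lim _ cvL).
apply: cvg_mx_entry => i j; rewrite mxE.
rewrite (_ : (fun n => _) = series (fun k => c k * (A ^+ k) i j)).
  exact: is_cvg_mx_pseries_entry.
apply/funext => n; rewrite series_mx_entry.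
by congr (series _ n); apply/funext => k; rewrite mxE.
Qed.

Lemma invfact_le k : `|k`!%:R^-1 : R| <= k`!%:R^-1.
Proof. by rewrite ger0_norm. Qed.

Lemma invfactS_le k : `|k.+1`!%:R^-1 : R| <= k`!%:R^-1.
Proof.
rewrite ger0_norm // lef_pV2 ?posrE ?ltr0n ?fact_gt0 // ler_nat.
by rewrite factS leq_pmull.
Qed.

(** phi1(A) A = exp A - 1: multiplying by A shifts the series by one index. *)
Lemma mul_phi1mx A : phi1mx A *m A = expmx A - 1%:M.
Proof.
have cvexp := @cvg_mx_pseries _ A invfact_le.
rewrite -(cvg_lim _ (cvg_mulmxr (B := A) (@cvg_mx_pseries _ A invfactS_le))) //.
apply/cvg_lim => //.
rewrite (_ : (fun n => _) =
  (fun n => series (fun k => k`!%:R^-1 *: A ^+ k) n.+1 - 1%:M)).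
  by apply: cvgB; [rewrite cvg_shiftS | exact: cvg_cst].
apply/funext => n; rewrite /series /= big_nat_recl // fact0 invr1 scale1r expr0.
rewrite [RHS]addrAC subrr add0r mulmx_suml; apply: eq_bigr => k _.
by rewrite exprmxSr scalemxAl.
Qed.

(** The entries of B exp(t A) are scalar power series in t; the left factor B
    makes this family closed under termwise differentiation. *)
Lemma cvg_pseries_expmx A B i j (t : R) :
  pseries (fun k => k`!%:R^-1 * (B *m A ^+ k) i j) t @ \oo -->
  (B *m expmx (t *: A)) i j.
Proof.
rewrite mxE.
rewrite (_ : pseries _ _ = fun n => \sum_l B i l *
    series (fun k => k`!%:R^-1 *: (t *: A) ^+ k) n l j).
  apply: (cvg_big add_continuous) => l _; apply: cvgMl_tmp.
  have cvexp := @cvg_mx_pseries _ (t *: A) invfact_le.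
  exact: cvg_comp cvexp (@coord_continuous _ _ _ l j _).
apply/funext => n; rewrite /pseries /series /=.
under [RHS]eq_bigr do rewrite summxE mulr_sumr.
rewrite exchange_big /=; apply: eq_bigr => k _.
rewrite mxE mulr_sumr mulr_suml; apply: eq_bigr => l _.
by rewrite exprZmx !mxE; ring.
Qed.

Lemma is_derive_expmx A i j (t : R) :
  is_derive t (1 : R) (fun s => expmx (s *: A) i j) ((A *m expmx (t *: A)) i j).
Proof.
(* Termwise differentiation turns the series with left factor B into the one
   with left factor B A. *)
pose u (B : 'M[R]_d) k := k`!%:R^-1 * (B *m A ^+ k) i j.
have diffs_u B : pseries_diffs (u B) = u (B *m A).
  apply/funext => k; rewrite /pseries_diffs /u exprmxS mulmxA.
  by rewrite factS natrM invfM mulrA mulVKf.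
have cv B K : cvgn (pseries (u B) K).
  by apply/cvg_ex; exists ((B *m expmx (K *: A)) i j); exact: cvg_pseries_expmx.
have lim_u B s : limn (pseries (u B) s) = (B *m expmx (s *: A)) i j.
  by apply: cvg_lim => //; exact: cvg_pseries_expmx.
rewrite (_ : (fun s => _) = (fun s => limn (pseries (u 1%:M) s))); last first.
  by apply/funext => s; rewrite lim_u mul1mx.
rewrite -lim_u (_ : u A = pseries_diffs (u 1%:M)); last first.
  by rewrite diffs_u mul1mx.
(* Any radius larger than |t| works, as the series converge everywhere. *)
apply: (pseries_snd_diffs (K := `|t| + 1)); rewrite ?diffs_u //.
by rewrite [ltRHS]ger0_norm ?addr_ge0 // ltrDl.
Qed.

End MatrixPowerSeries.

(** * Integral of a finite sum *)

Section RintegralSum.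
Context (dT : measure_display) (T : measurableType dT) (R : realType).
Context (mu : {measure set T -> \bar R}) (E : set T) (I : Type).
Context (f : I -> T -> R).
Hypotheses (mE : measurable E).
Hypothesis intf : forall i, mu.-integrable E (EFin \o f i).

Lemma integrable_EFin_sum (s : seq I) :
  mu.-integrable E (EFin \o (fun t => \sum_(i <- s) f i t)).
Proof.
rewrite (_ : _ \o _ = (fun t => \sum_(i <- s) (EFin \o f i) t)%E).
  by apply: integrable_sum => // i _; exact: intf.
by apply/funext => t /=; rewrite sumEFin.
Qed.

Lemma Rintegral_sum (s : seq I) :
  Rintegral mu E (fun t => \sum_(i <- s) f i t) =
  \sum_(i <- s) Rintegral mu E (f i).
Proof.
elim: s => [|i s IHs].
  rewrite big_nil (_ : (fun t => _) = cst 0) ?Rintegral_cst ?mul0r //.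
  by apply/funext => t; rewrite big_nil.
rewrite big_cons -IHs -RintegralD //; last exact: integrable_EFin_sum.
by congr Rintegral; apply/funext => t; rewrite big_cons.
Qed.

End RintegralSum.

(** * Quadratic forms and their decay along matrix exponentials *)

Section QuadraticForms.
Variables (R : realType) (d : nat).
Implicit Types (B M S : 'M[R]_d) (x y z : 'cV[R]_d).

Lemma dotvE x y : dotv x y = \sum_i x i 0 * y i 0.
Proof. by rewrite /dotv mxE; apply: eq_bigr => i _; rewrite mxE. Qed.

Lemma dotvC x y : dotv x y = dotv y x.
Proof. by rewrite !dotvE; apply: eq_bigr => i _; rewrite mulrC. Qed.

Lemma dotvDr x y z : dotv x (y + z) = dotv x y + dotv x z.
Proof. by rewrite /dotv mulmxDr mxE. Qed.

Lemma dotvDl x y z : dotv (y + z) x = dotv y x + dotv z x.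
Proof. by rewrite dotvC dotvDr !(dotvC x). Qed.

Lemma dotvNr x y : dotv x (- y) = - dotv x y.
Proof. by rewrite /dotv mulmxN mxE. Qed.

Lemma dotvZr a x y : dotv x (a *: y) = a * dotv x y.
Proof. by rewrite /dotv -scalemxAr mxE. Qed.

Lemma dotv_trmx B x y : dotv x (B *m y) = dotv (B^T *m x) y.
Proof. by rewrite /dotv trmx_mul trmxK mulmxA. Qed.

Lemma dotv_symm B x : dotv x (symm B *m x) = dotv x (B *m x).
Proof.
rewrite /symm -scalemxAl mulmxDl dotvZr dotvDr (dotv_trmx B^T) trmxK.
by rewrite (dotvC (B *m x)); field.
Qed.

(** In the skew case the form vanishes identically. *)
Lemma quad_skew_nsd S x : S^T = - S \/ nsd (symm S) -> dotv x (S *m x) <= 0.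
Proof.
case=> [skewS | [_ nS]]; last by rewrite -dotv_symm.
have : dotv x (S *m x) = - dotv x (S *m x).
  by rewrite {1}dotv_trmx skewS mulNmx dotvC dotvNr.
lra.
Qed.

Lemma spd_unitmx M : spd M -> M \in unitmx.
Proof.
case=> symM posM; rewrite unitmxE unitfE; apply/det0P => -[v v0 vM].
have vT0 : v^T != 0 by rewrite -(inj_eq trmx_inj) trmxK trmx0.
by have := posM _ vT0; rewrite /dotv trmxK mulmxA vM mul0mx mxE ltxx.
Qed.

Lemma expmx0 : expmx (0 : 'M[R]_d) = 1%:M.
Proof. by have := mul_phi1mx (0 : 'M[R]_d); rewrite mulmx0 => /esym/subr0_eq. Qed.

(** Symmetry of M suffices: the form of M need not be definite. *)
Lemma expmx_contraction M B x : M^T = M ->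
  (forall y, dotv y (M *m B *m y) <= 0) ->
  dotv (expmx B *m x) (M *m (expmx B *m x)) <= dotv x (M *m x).
Proof.
move=> symM negMB.
pose y t := expmx (t *: B) *m x.
pose q t := dotv (y t) (M *m y t).
have dy t i : is_derive t (1 : R) (fun s => y s i 0) ((B *m y t) i 0).
  rewrite (_ : (fun s => _) =
      \sum_j (fun s => expmx (s *: B) i j) * cst (x j 0)); last first.
    by apply/funext => s; rewrite fct_sumE /y mxE.
  have dE j := is_deriveM (is_derive_expmx B i j t)
    (is_derive_cst (x j 0) t (1 : R)).
  apply: (is_derive_eq (is_derive_sum dE)).
  rewrite /y mulmxA mxE; apply: eq_bigr => j _.
  by rewrite scaler0 add0r mulrC.
have dMy t i : is_derive t (1 : R) (fun s => (M *m y s) i 0)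
    ((M *m (B *m y t)) i 0).
  rewrite (_ : (fun s => _) =
      \sum_j cst (M i j) * (fun s => y s j 0)); last first.
    by apply/funext => s; rewrite fct_sumE mxE.
  have dE j := is_deriveM (is_derive_cst (M i j) t (1 : R)) (dy t j).
  apply: (is_derive_eq (is_derive_sum dE)).
  rewrite [RHS]mxE; apply: eq_bigr => j _.
  by rewrite scaler0 addr0.
have dq t : is_derive t (1 : R) q (2 * dotv (y t) (M *m B *m y t)).
  rewrite (_ : q = \sum_i (fun s => y s i 0) * (fun s => (M *m y s) i 0));
    last by apply/funext => s; rewrite fct_sumE /q dotvE.
  have dE i := is_deriveM (dy t i) (dMy t i).
  apply: (is_derive_eq (is_derive_sum dE)).
  rewrite big_split /= -!dotvE.
  by rewrite -[X in dotv (X *m _)]symM -dotv_trmx !mulmxA; ring.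
suff : q 1 <= q 0.
  by rewrite /q /y scale1r scale0r expmx0 mul1mx.
apply: (@ler0_derive1_le_cc _ q 0 1); rewrite ?in_itv /= ?lexx ?ler01 //.
- by move=> t _; case: (dq t) => _ dqt; rewrite derive1E dqt mulr_ge0_le0.
- by apply: derivable_within_continuous => t _; case: (dq t).
Qed.

Lemma quad_integral_mx M (D : R -> 'M[R]_d) (a b : R) x : continuous D ->
  dotv x (M *m integral_mx D a b *m x) =
  Rintegral lebesgue_measure `[a, b] (fun t => dotv x (M *m D t *m x)).
Proof.
move=> contD.
have intD i j : lebesgue_measure.-integrable `[a, b]
    (EFin \o (fun t => D t i j)).
  apply: continuous_compact_integrable; first exact: segment_compact.
  apply: continuous_subspaceT => t.
  exact: cvg_comp (contD t) (@coord_continuous _ _ _ i j _).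
have quadE B : dotv x (M *m B *m x) =
    \sum_i \sum_j (x^T *m M) 0 i * x j 0 * B i j.
  rewrite /dotv !mulmxA -mulmxA mxE; apply: eq_bigr => i _.
  by rewrite [X in _ * X]mxE mulr_sumr; apply: eq_bigr => j _; ring.
rewrite quadE (_ : (fun t => _) = fun t =>
  \sum_i \sum_j (x^T *m M) 0 i * x j 0 * D t i j); last first.
  by apply/funext => t; exact: quadE.
have intcD i j : lebesgue_measure.-integrable `[a, b]
    (EFin \o (fun t => (x^T *m M) 0 i * x j 0 * D t i j)).
  exact: (integrableZl _ ((x^T *m M) 0 i * x j 0) (intD i j)).
rewrite Rintegral_sum => [|//|i]; last exact: integrable_EFin_sum.
apply: eq_bigr => i _; rewrite Rintegral_sum //; apply: eq_bigr => j _.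
by rewrite RintegralZl // [X in _ * X]mxE.
Qed.

Lemma damping_flow_contraction M (D : R -> 'M[R]_d) (a b : R) x : spd M ->
  continuous D -> (forall t, psd (symm (M *m D t))) ->
  dotv (damping_flow D a b *m x) (M *m (damping_flow D a b *m x)) <=
  dotv x (M *m x).
Proof.
move=> [symM _] contD dampD; apply: expmx_contraction => // y.
rewrite mulmxN mulNmx dotvNr oppr_le0 quad_integral_mx //.
by apply: Rintegral_ge0 => t _; rewrite -dotv_symm; case: (dampD t).
Qed.

(** One step of the exponential integrator with a constant force g dissipates
    the quadratic energy tilted by the linear potential of g. *)
Lemma exp_integrator_dissipation M S (h : R) x y g : spd M ->
  S^T = - S \/ nsd (symm S) -> 0 <= h ->
  y = expmx (h *: (S *m M)) *m x + h *: (phi1mx (h *: (S *m M)) *m S *m g) ->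
  2^-1 * dotv y (M *m y) + dotv g y <= 2^-1 * dotv x (M *m x) + dotv g x.
Proof.
move=> spdM dissS h_ge0 yE; have [symM _] := spdM.
set A := h *: (S *m M) in yE *.
pose w := invmx M *m g.
have Mw : M *m w = g by rewrite mulKVmx // spd_unitmx.
(* As S g = S M w, the forcing term is phi1(A) A w = exp A w - w. *)
have shiftE : y + w = expmx A *m (x + w).
  have -> : y = expmx A *m x + phi1mx A *m A *m w.
    rewrite yE; congr (_ + _).
    by rewrite -Mw /A -!scalemxAr -scalemxAl !mulmxA.
  by rewrite mul_phi1mx mulmxBl mul1mx mulmxDr addrA subrK.
have negMA z : dotv z (M *m A *m z) <= 0.
  rewrite /A -scalemxAr -scalemxAl dotvZr mulr_ge0_le0 //.
  by rewrite -!mulmxA dotv_trmx symM quad_skew_nsd.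
have quadD z : dotv (z + w) (M *m (z + w)) =
    dotv z (M *m z) + 2 * dotv g z + dotv w (M *m w).
  rewrite mulmxDr !dotvDl !dotvDr Mw (dotvC z g).
  by rewrite (dotv_trmx M w z) symM Mw; ring.
(* Both sides contain the same constant w^T M w, which cancels. *)
have := expmx_contraction (x + w) symM negMA.
by rewrite -shiftE !quadD; lra.
Qed.

End QuadraticForms.

(** * Energy dissipation of the splitting step *)

Theorem theorem4p3 (R : realType) (d : nat)
    (M S : 'M[R]_d) (V : 'cV[R]_d -> R) (D : R -> 'M[R]_d)
    (h tn tn1 : R) (A : 'M[R]_d)
    (zn zm zp zn1 zhat gt : 'cV[R]_d) (Vm Vp eta : R) :
  spd M ->
  S^T = - S \/ nsd (symm S) ->
  (forall z : 'cV[R]_d, differentiable V z) ->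
  continuous D ->
  (forall t : R, psd (symm (M *m D t))) ->
  0 < h ->
  tn1 = tn + h ->
  A = h *: (S *m M) ->
  gt = gradient V zhat ->
  (zm, Vm) = (damping_flow D tn (tn + h / 2) *m zn, V zn) ->
  zp = expmx A *m zm + h *: (phi1mx A *m S *m (eta *: gt)) ->
  Vp - Vm = eta * dotv gt (zp - zm) ->
  (zn1, V zn1) = (damping_flow D (tn + h / 2) tn1 *m zp, Vp) ->
  energy M V zn1 - energy M V zn <= 0.
Proof.
move=> spdM dissS _ contD dampD h_gt0 _ -> _ [zmE VmE] zpE potE [zn1E Vn1E].
have damp1 := damping_flow_contraction tn (tn + h / 2) zn spdM contD dampD.
have damp2 := damping_flow_contraction (tn + h / 2) tn1 zp spdM contD dampD.
have core := exp_integrator_dissipation spdM dissS (ltW h_gt0) zpE.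
rewrite -zmE in damp1; rewrite -zn1E in damp2.
move: potE core; rewrite /energy Vn1E -VmE !(dotvC (eta *: gt)) !dotvZr.
rewrite dotvDr dotvNr !(dotvC gt).
lra.
Qed.
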